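(* Let $X$ be a smooth affine algebraic variety over $\mathbb{C}$, and let $r$ be a geometric classical r-matrix on $X$. Then $r$ admits a quantization; that is, there exists a geometric quantum R-matrix $R:\mathbb{C}[X\times X]\to\mathbb{C}[X\times X][[\hbar]]$ on $X$ such that $R=1+\hbar r+O(\hbar^2)$.
   Context: A geometric classical r-matrix on $X$ is a derivation $r:\mathbb{C}[X\times X]\to\mathbb{C}[X\times X]$ over $\mathbb{C}$ (i.e. a vector field on $X\times X$) satisfying the classical Yang-Baxter equation $[r_{12},r_{13}]+[r_{12},r_{23}]+[r_{13},r_{23}]=0$ as operators on $\mathbb{C}[X\times X\times X]$, and the unitarity condition $r+r_{21}=0$ on $\mathbb{C}[X\times X]$. Here $\mathbb{C}[X\times X]=\mathbb{C}[X]\otimes\mathbb{C}[X]$, $\mathbb{C}[X\times X\times X]=\mathbb{C}[X]^{\otimes 3}$, $r_{ij}$ denotes $r$ acting in the $i$-th and $j$-th tensor factors (in this order) and identically in the remaining one, the bracket is the commutator of operators, and $r_{21}=\sigma r\sigma$ with $\sigma$ the flip of the two tensor factors. A formal diffeomorphism $g$ of a smooth affine variety $Y$ is a $\mathbb{C}$-algebra homomorphism $g:\mathbb{C}[Y]\to\mathbb{C}[Y][[\hbar]]$ such that $g=1+O(\hbar)$, i.e. $g(F)\equiv F$ modulo $\hbar$ for all $F\in\mathbb{C}[Y]$. Formal diffeomorphisms are extended $\mathbb{C}[[\hbar]]$-linearly and $\hbar$-adically continuously to $\mathbb{C}[Y][[\hbar]]$, so that they can be composed. A geometric quantum R-matrix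 on $X$ is a formal diffeomorphism $R$ of $X\times X$ satisfying the quantum Yang-Baxter equation $R_{12}R_{13}R_{23}=R_{23}R_{13}R_{12}$ on $\mathbb{C}[X\times X\times X][[\hbar]]$ and the unitarity condition $RR_{21}=1$, where $R_{ij}$ denotes $R$ acting in the $i$-th and $j$-th factors (in this order) and $R_{21}=\sigma R\sigma$. The condition $R=1+\hbar r+O(\hbar^2)$ means $R(F)\equiv F+\hbar\, r(F)$ modulo $\hbar^2$ for all $F\in\mathbb{C}[X\times X]$. *)

(* Defs.v *)
From HB Require Import structures.
From mathcomp Require Import all_boot all_order all_algebra.
From mathcomp Require Import boolp classical_sets functions reals.
From mathcomp Require Import complex mpoly.

Set Implicit Arguments.
Unset Strict Implicit.
Unset Printing Implicit Defensive.

Import GRing.Theory.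
Local Open Scope classical_set_scope.
Local Open Scope ring_scope.

Section Varieties.
Context {K : fieldType} {n : nat}.
Implicit Types (X Z : set 'rV[K]_n) (p : 'rV[K]_n).

Definition zariski_closed X :=
  exists S : set {mpoly K[n]},
    X = [set x | forall f, S f -> f.@[x 0] = 0].

Definition vanishing_ideal X : set {mpoly K[n]} :=
  [set f | forall x, X x -> f.@[x 0] = 0].

Definition irreducible_closed Z :=
  [/\ zariski_closed Z, Z !=set0 &
      forall A B, zariski_closed A -> zariski_closed B ->
        Z `<=` A `|` B -> Z `<=` A \/ Z `<=` B].

Definition irreducible_chain X p (d : nat) (Z : nat -> set 'rV[K]_n) :=
  (forall i, (i <= d)%N -> [/\ irreducible_closed (Z i), Z i p & Z i `<=` X])
  /\ (forall i, (i < d)%N -> Z i `<` Z i.+1).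

(* The dimension of X at p, i.e. the Krull dimension of the local ring at p:
   chains of primes contained in the maximal ideal of p correspond to chains
   of irreducible closed subsets of X through p. *)
Definition local_dim X p (d : nat) :=
  (exists Z : nat -> set 'rV[K]_n, irreducible_chain X p d Z)
  /\ (forall e (Z : nat -> set 'rV[K]_n),
        irreducible_chain X p e Z -> (e <= d)%N).

Definition tangent_space X p : set 'rV[K]_n :=
  [set w | forall f, vanishing_ideal X f ->
             \sum_(i < n) (mderiv i f).@[p 0] * w 0 i = 0].

Definition has_dim (V : set 'rV[K]_n) (d : nat) :=
  exists B : 'M[K]_(d, n), row_free B /\ V = [set w | (w <= B)%MS].

Definition smooth X :=
  forall p, X p -> exists d, local_dim X p d /\ has_dim (tangent_space X p) d.

Definition smooth_affine_variety X := zariski_closed X /\ smooth X.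

End Varieties.

Section CoordinateRing.
Context {K : fieldType} {m : nat} (Y : set 'rV[K]_m).

Definition regular (f : Y -> K) : Prop :=
  exists p : {mpoly K[m]}, forall y : Y, f y = p.@[val y 0].

(* K^o, not K, so that functions on Y inherit a K-module structure *)
Definition regular_fun : {pred Y -> K^o} :=
  [pred f : Y -> K^o | `[< regular f >]].

Lemma regular_subring : subring_closed regular_fun.
Proof.
split.
- by apply/asboolP; exists 1 => y; rewrite meval1.
- move=> f g /asboolP[p fp] /asboolP[q gq]; apply/asboolP; exists (p - q).
  by move=> y; rewrite mevalB -fp -gq.
- move=> f g /asboolP[p fp] /asboolP[q gq]; apply/asboolP; exists (p * q).
  by move=> y; rewrite mevalM -fp -gq.
Qed.

Lemma regular_scale : GRing.scaler_closed regular_fun.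
Proof.
move=> a f /asboolP[p fp]; apply/asboolP; exists (a *: p) => y.
by rewrite mevalZ -fp.
Qed.

HB.instance Definition _ :=
  GRing.isSubringClosed.Build (Y -> K^o) regular_fun regular_subring.
HB.instance Definition _ :=
  GRing.isScaleClosed.Build K (Y -> K^o) regular_fun regular_scale.

Record coord_ring := CoordRing {
  coord_fun :> Y -> K^o;
  _ : coord_fun \in regular_fun
}.

HB.instance Definition _ := [isSub of coord_ring for coord_fun].
HB.instance Definition _ := [Choice of coord_ring by <:].
HB.instance Definition _ :=
  GRing.SubChoice_isSubComPzRing.Build _ _ coord_ring (GRing.subringClosedP _).
HB.instance Definition _ := [SubZmodule_isSubLmodule of coord_ring by <:].

Lemma coordP (f g : coord_ring) : (forall y, f y = g y) -> f = g.
Proof. by move=> fg; apply: val_inj; apply: funext. Qed.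

Lemma coord_regular (f : coord_ring) : regular f.
Proof. by case: f => f fP; exact: (asboolW fP). Qed.

Definition coord_of (f : Y -> K) (fP : regular f) : coord_ring :=
  CoordRing (asboolT fP : (f : Y -> K^o) \in regular_fun).

Lemma coord0E y : (0 : coord_ring) y = 0. Proof. by []. Qed.
Lemma coord1E y : (1 : coord_ring) y = 1. Proof. by []. Qed.
Lemma coordDE (f g : coord_ring) y : (f + g) y = f y + g y. Proof. by []. Qed.
Lemma coordNE (f : coord_ring) y : (- f) y = - f y. Proof. by []. Qed.
Lemma coordME (f g : coord_ring) y : (f * g) y = f y * g y. Proof. by []. Qed.
Lemma coordZE a (f : coord_ring) y : (a *: f) y = a * f y. Proof. by []. Qed.

Lemma coord_sumE (I : Type) (s : seq I) (F : I -> coord_ring) y :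
  (\sum_(i <- s) F i) y = \sum_(i <- s) F i y.
Proof.
by elim: s => [|i s IH]; rewrite ?big_nil ?coord0E// !big_cons coordDE IH.
Qed.

Lemma regular_cst (c : K) : regular (fun _ => c).
Proof. by exists c%:MP => y; rewrite mevalC. Qed.

Lemma regular_coordinate (l : 'I_m) :
  regular (fun y : Y => val y 0 l).
Proof. by exists 'X_l => y; rewrite mevalXU. Qed.

End CoordinateRing.

Arguments regular {K m} Y f.
Arguments regular_cst {K m} Y c.

Section Pullback.
Context {K : fieldType} {m m' m'' : nat}.
Context {Y : set 'rV[K]_m} {W : set 'rV[K]_m'} {Z : set 'rV[K]_m''}.

Lemma regular_comp (phi : Y -> Z) (f : coord_ring Z) :
  (forall l, regular Y (fun y => val (phi y) 0 l)) ->
  regular Y (fun y => f (phi y)).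
Proof.
move=> phiP; have [p fp] := coord_regular f.
have [q qP] := choice phiP.
exists (p \mPo [tuple q l | l < m'']) => y.
rewrite comp_mpoly_meval fp; apply: meval_eq => l.
by rewrite tnth_mktuple -qP.
Qed.

(* A regular function on a product is a finite sum of products of regular
   functions on the factors. *)
Lemma regular_split (phi : Y -> W -> Z) (f : coord_ring Z) :
  (forall l, (exists g : coord_ring Y, forall y w, val (phi y w) 0 l = g y) \/
             (exists g : coord_ring W, forall y w, val (phi y w) 0 l = g w)) ->
  exists s : seq (coord_ring Y * coord_ring W),
    forall y w, f (phi y w) = \sum_(ab <- s) ab.1 y * ab.2 w.
Proof.
move=> phiP; have [p fp] := coord_regular f.
pose D (h : Y -> W -> K) := exists s : seq (coord_ring Y * coord_ring W),
  forall y w, h y w = \sum_(ab <- s) ab.1 y * ab.2 w.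
have Dadd h1 h2 : D h1 -> D h2 -> D (fun y w => h1 y w + h2 y w).
  move=> [s1 s1P] [s2 s2P]; exists (s1 ++ s2) => y w.
  by rewrite big_cat /= s1P s2P.
have Dmul h1 h2 : D h1 -> D h2 -> D (fun y w => h1 y w * h2 y w).
  move=> [s1 s1P] [s2 s2P].
  exists [seq (a.1 * b.1, a.2 * b.2) | a <- s1, b <- s2] => y w.
  rewrite s1P s2P big_allpairs_dep mulr_suml; apply: eq_bigr => a _.
  rewrite mulr_sumr; apply: eq_bigr => b _.
  exact: mulrACA.
have DY (g : coord_ring Y) : D (fun y _ => g y).
  by exists [:: (g, 1)] => y w; rewrite big_seq1 [RHS]mulr1.
have DW (g : coord_ring W) : D (fun _ w => g w).
  by exists [:: (1, g)] => y w; rewrite big_seq1 [RHS]mul1r.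
have DC c : D (fun _ _ => c) by exact: (DY (coord_of (regular_cst Y c))).
suff [s sP] : D (fun y w => p.@[val (phi y w) 0]).
  by exists s => y w; rewrite fp sP.
have Deq h h' : (forall y w, h y w = h' y w) -> D h' -> D h.
  by move=> hh' [t tP]; exists t => y w; rewrite hh'.
have Dl l : D (fun y w => val (phi y w) 0 l).
  by have [[g gE]|[g gE]] := phiP l; apply: Deq gE _.
have Dexp h k : D h -> D (fun y w => h y w ^+ k).
  move=> Dh; elim: k => [|k IH]; first exact: (DC 1).
  by apply: Deq (Dmul _ _ Dh IH) => y w; rewrite exprS.
have Dsum (I : Type) (t : seq I) (h : I -> Y -> W -> K) :
    (forall i, D (h i)) -> D (fun y w => \sum_(i <- t) h i y w).
  move=> Dh; elim: t => [|i t IH].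
    by apply: Deq (DC 0) => y w; rewrite big_nil.
  by apply: Deq (Dadd _ _ (Dh i) IH) => y w; rewrite big_cons.
have Dprod (I : Type) (t : seq I) (h : I -> Y -> W -> K) :
    (forall i, D (h i)) -> D (fun y w => \prod_(i <- t) h i y w).
  move=> Dh; elim: t => [|i t IH].
    by apply: Deq (DC 1) => y w; rewrite big_nil.
  by apply: Deq (Dmul _ _ (Dh i) IH) => y w; rewrite big_cons.
apply: Deq => [y w|]; first exact: mevalE.
by apply: Dsum => mu; apply: Dmul (DC _) _; apply: Dprod => l; exact: Dexp.
Qed.

End Pullback.

Section Powers.
Context {K : fieldType} {n : nat} (X : set 'rV[K]_n).

(* X^k inside the affine space of k x n matrices *)
Definition power (k : nat) : set 'rV[K]_(k * n) :=
  [set v | forall a : 'I_k, X (row a (vec_mx v))].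
Arguments power : clear implicits.

Lemma factor_subproof k (v : power k) (a : 'I_k) :
  row a (vec_mx (val v)) \in X.
Proof. by apply/mem_set; exact: (set_mem (valP v)). Qed.

Definition factor k (v : power k) (a : 'I_k) : X :=
  exist (fun x => x \in X) _ (factor_subproof v a).

Lemma of_factors_subproof k (x : 'I_k -> X) :
  mxvec (\matrix_(a < k) val (x a)) \in power k.
Proof.
by apply/mem_set => a; rewrite mxvecK rowK; exact: (set_mem (valP (x a))).
Qed.

Definition of_factors k (x : 'I_k -> X) : power k :=
  exist (fun v => v \in power k) _ (of_factors_subproof x).

Lemma of_factorsK k (x : 'I_k -> X) a : factor (of_factors x) a = x a.
Proof. by apply: val_inj; rewrite /= mxvecK rowK. Qed.

Lemma factorK k (v : power k) : of_factors (factor v) = v.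
Proof.
apply: val_inj => /=; rewrite -[RHS]vec_mxK; congr mxvec.
by apply/row_matrixP => a; rewrite rowK.
Qed.

Lemma of_factors_coordE k (x : 'I_k -> X) (a : 'I_k) (c : 'I_n) :
  val (of_factors x) 0 (mxvec_index a c) = val (x a) 0 c.
Proof. by rewrite /= mxvecE mxE. Qed.

Lemma factor_regular k (a : 'I_k) (c : 'I_n) :
  regular (power k) (fun v : power k => val (factor v a) 0 c).
Proof.
rewrite (_ : (fun _ => _) = (fun v : power k => val v 0 (mxvec_index a c))).
  exact: regular_coordinate.
by apply/funext => v; rewrite /= mxE mxE.
Qed.

(* the flip sigma of the two factors *)
Definition swap (w : power 2) : power 2 :=
  of_factors (fun a => factor w (rev_ord a)).

Lemma flip_subproof (F : coord_ring (power 2)) :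
  regular (power 2) (fun w => F (swap w)).
Proof.
apply: regular_comp => l; case/mxvec_indexP: l => a c.
under eq_fun do rewrite of_factors_coordE; exact: factor_regular.
Qed.

Definition flip (F : coord_ring (power 2)) : coord_ring (power 2) :=
  coord_of (flip_subproof F).

Section Legs.
Context {k : nat} (i j : 'I_k).

(* the pair of the i-th and j-th factors of v *)
Definition legs (v : power k) : power 2 :=
  of_factors (fun b : 'I_2 => factor v (if b == ord0 then i else j)).

(* v with its i-th and j-th factors replaced by those of w *)
Definition set_legs (v : power k) (w : power 2) : power k :=
  of_factors (fun a => if a == i then factor w ord0
                  else if a == j then factor w ord_max else factor v a).

Lemma slice_subproof (F : coord_ring (power k)) (v : power k) :
  regular (power 2) (fun w => F (set_legs v w)).
Proof.
apply: regular_comp => l; case/mxvec_indexP: l => a c.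
under eq_fun do rewrite of_factors_coordE.
case: (a == i); first exact: factor_regular.
case: (a == j); [exact: factor_regular|exact: regular_cst].
Qed.

(* F as a function of its i-th and j-th arguments, the others being those
   of v *)
Definition slice (F : coord_ring (power k)) (v : power k)
    : coord_ring (power 2) :=
  coord_of (slice_subproof F v).

Lemma pull_legs_subproof (G : coord_ring (power 2)) :
  regular (power k) (fun v => G (legs v)).
Proof.
apply: regular_comp => l; case/mxvec_indexP: l => b c.
under eq_fun do rewrite of_factors_coordE; exact: factor_regular.
Qed.

Definition pull_legs (G : coord_ring (power 2)) : coord_ring (power k) :=
  coord_of (pull_legs_subproof G).

Lemma slice_split (F : coord_ring (power k)) :
  exists s : seq (coord_ring (power k) * coord_ring (power 2)),
    forall v, slice F v = \sum_(ab <- s) (ab.1 v : K) *: ab.2.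
Proof.
have [|s sP] := @regular_split _ _ _ _ (power k) (power 2) (power k) set_legs F.
  move=> l; case/mxvec_indexP: l => a c.
  case: (eqVneq a i) => [ai|ai].
    right; exists (coord_of (factor_regular (ord0 : 'I_2) c)) => v w.
    by rewrite of_factors_coordE ai eqxx.
  case: (eqVneq a j) => [aj|aj].
    right; exists (coord_of (factor_regular (ord_max : 'I_2) c)) => v w.
    by rewrite of_factors_coordE (negbTE ai) aj eqxx.
  left; exists (coord_of (factor_regular a c)) => v w.
  by rewrite of_factors_coordE (negbTE ai) (negbTE aj).
exists s => v; apply: coordP => w; rewrite coord_sumE.
exact: sP.
Qed.

Lemma leg_subproof (T : {linear coord_ring (power 2) -> coord_ring (power 2)})
    (F : coord_ring (power k)) :
  regular (power k) (fun v => T (slice F v) (legs v)).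
Proof.
have [s sP] := slice_split F.
suff -> : (fun v => T (slice F v) (legs v)) =
    ((\sum_(ab <- s) ab.1 * pull_legs (T ab.2)) : coord_ring _).
  exact: coord_regular.
apply/funext => v; rewrite sP linear_sum !coord_sumE.
by apply: eq_bigr => ab _; rewrite linearZ.
Qed.

(* T_{ij}: T acts in the i-th and j-th tensor factors (in this order) and
   identically in the remaining ones; see leg_tensor. *)
Definition leg (T : {linear coord_ring (power 2) -> coord_ring (power 2)})
    (F : coord_ring (power k)) : coord_ring (power k) :=
  coord_of (leg_subproof T F).

Lemma leg_tensor (T : {linear coord_ring (power 2) -> coord_ring (power 2)})
    (G : coord_ring (power 2)) (H : coord_ring (power k)) :
  i != j -> (forall v w, H (set_legs v w) = H v) ->
  leg T (pull_legs G * H) = pull_legs (T G) * H.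
Proof.
move=> ij HP; apply: coordP => v.
rewrite [LHS]/(T (slice (pull_legs G * H) v) (legs v)).
have -> : slice (pull_legs G * H) v = (H v : K) *: G.
  apply: coordP => w.
  rewrite [LHS]/(G (legs (set_legs v w)) * H (set_legs v w)).
  rewrite HP coordZE [LHS](@mulrC K); congr (_ * G _).
  rewrite /legs -[RHS]factorK; congr of_factors; apply/funext => b.
  rewrite of_factorsK; case: (eqVneq b ord0) => [->|b0]; first by rewrite eqxx.
  rewrite eq_sym (negbTE ij) eqxx; congr factor; apply: val_inj => /=.
  by case: b b0 => [[|[|]]].
by rewrite linearZ; exact: (@mulrC K).
Qed.

End Legs.

End Powers.

Arguments power {K n} X k.

(* formal power series A[[h]]; u k is the coefficient of h^k *)
Definition fps (A : Type) := nat -> A.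

HB.instance Definition _ (A : zmodType) :=
  GRing.Zmodule.copy (fps A) (nat -> A).
HB.instance Definition _ (K : pzRingType) (A : lmodType K) :=
  GRing.Lmodule.copy (fps A) (nat -> A).

Section FpsRing.
Context {A : comPzRingType}.
Implicit Types u v w : fps A.

Definition fps_one : fps A := fun k => (k == 0%N)%:R.
Definition fps_mul u v : fps A :=
  fun k => \sum_(i < k.+1) u i * v (k - i)%N.

Lemma fps_mulC : commutative fps_mul.
Proof.
move=> u v; apply/funext => k; rewrite /fps_mul (reindex_inj rev_ord_inj) /=.
by apply: eq_bigr => i _; rewrite subSS mulrC subKn // -ltnS.
Qed.

Lemma fps_mul1 : left_id fps_one fps_mul.
Proof.
move=> u; apply/funext => k; rewrite /fps_mul big_ord_recl /= mul1r subn0.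
by rewrite big1 ?addr0// => i _; rewrite /fps_one /= mul0r.
Qed.

Lemma fps_mulDl : left_distributive fps_mul +%R.
Proof.
move=> u v w; apply/funext => k; rewrite /fps_mul.
transitivity (\sum_(i < k.+1) (u i * w (k - i)%N + v i * w (k - i)%N)).
  by apply: eq_bigr => i _; exact: mulrDl.
by rewrite big_split.
Qed.

Lemma fps_mulA : associative fps_mul.
Proof.
move=> u v w; apply/funext => k; rewrite /fps_mul.
pose c i j := u i * (v (j - i)%N * w (k - j)%N).
transitivity (\sum_(i < k.+1) \sum_(j < k.+1 | (i <= j)%N) c i j).
  apply: eq_bigr => i _; rewrite mulr_sumr.
  have ik : (i <= k)%N by rewrite -ltnS.
  rewrite -(big_mkord xpredT (fun j => u i * (v j * w (k - i - j)%N))).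
  rewrite -(big_mkord (fun j => i <= j)%N (c i)).
  rewrite [RHS](big_cat_nat (leq0n i) (leqW ik)) /=.
  rewrite [X in _ = X + _]big_nat_cond [X in _ = X + _]big1 ?add0r; last first.
    by move=> j /andP[/andP[_ ji]]; rewrite leqNgt ji.
  rewrite [RHS](_ : _ = \sum_(0 + i <= j < k.+1 | (i <= j)%N) c i j) //.
  rewrite big_addn subSn // big_nat_cond [RHS]big_nat_cond.
  apply: eq_big => [j|j /andP[/andP[_ jk] _]]; first by rewrite leq_addl.
  by rewrite /c addnK addnC subnDA.
rewrite (exchange_big_dep xpredT) //=; apply: eq_bigr => j _.
rewrite mulr_suml.
rewrite -(big_mkord (fun i => i <= j)%N (fun i => c i j)).
rewrite -(big_mkord xpredT (fun i => u i * v (j - i)%N * w (k - j)%N)).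
rewrite [LHS](big_cat_nat (leq0n j.+1) (ltn_ord j)) /= [X in _ + X]big_nat_cond.
rewrite [X in _ + X]big1 ?addr0; last first.
  by move=> i /andP[/andP[ji _]]; rewrite leqNgt ji.
rewrite big_nat_cond [RHS]big_nat_cond.
apply: eq_big => [i|i _]; last by rewrite /c mulrA.
by rewrite andbT; case: ltnP => //; rewrite andbF.
Qed.

HB.instance Definition _ := GRing.Zmodule_isComPzRing.Build (fps A)
  fps_mulA fps_mulC fps_mul1 fps_mulDl.

(* The product of fps A is the Cauchy product, not the pointwise product that
   nat -> A carries as a function type. *)
Lemma fpsME u v k : (u * v) k = \sum_(i < k.+1) u i * v (k - i)%N.
Proof. by []. Qed.

Lemma fps1E k : (1 : fps A) k = (k == 0%N)%:R.
Proof. by []. Qed.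

End FpsRing.

Section FpsCoef.
Context {K : pzRingType} {A : lmodType K}.

Definition fps_coef (k : nat) (u : fps A) : A := u k.

Lemma fps_coef_linear k : linear (fps_coef k).
Proof. by []. Qed.

HB.instance Definition _ k :=
  GRing.isLinear.Build K (fps A) A _ (fps_coef k) (fps_coef_linear k).

(* the K[[h]]-linear, h-adically continuous extension of g to A[[h]] *)
Definition fps_ext (g : A -> fps A) (u : fps A) : fps A :=
  fun k => \sum_(l < k.+1) g (u (k - l)%N) l.

End FpsCoef.

Section RMatrices.
Context {K : fieldType}.

(* Together with the linearity built in the type of g, this says that g is a
   homomorphism of K-algebras congruent to the identity modulo h. *)
Definition formal_diffeomorphism (m : nat) (Y : set 'rV[K]_m)
    (g : {linear coord_ring Y -> fps (coord_ring Y)}) :=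
  monoid_morphism g /\ (forall F, g F 0%N = F).

Context {n : nat} {X : set 'rV[K]_n}.

Definition derivation
    (r : {linear coord_ring (power X 2) -> coord_ring (power X 2)}) :=
  forall F G, r (F * G) = r F * G + F * r G.

Definition commutator (V : zmodType) (S T : V -> V) (F : V) :=
  S (T F) - T (S F).

Definition classical_YBE
    (r : {linear coord_ring (power X 2) -> coord_ring (power X 2)}) :=
  let r12 := leg (inord 0 : 'I_3) (inord 1) r in
  let r13 := leg (inord 0 : 'I_3) (inord 2) r in
  let r23 := leg (inord 1 : 'I_3) (inord 2) r in
  forall F : coord_ring (power X 3),
    commutator r12 r13 F + commutator r12 r23 F + commutator r13 r23 F = 0.

Definition geometric_classical_rmatrix
    (r : {linear coord_ring (power X 2) -> coord_ring (power X 2)}) :=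
  [/\ derivation r, classical_YBE r &
      forall F, r F + flip (r (flip F)) = 0].

Definition fps_leg (k : nat) (i j : 'I_k)
    (g : {linear coord_ring (power X 2) -> fps (coord_ring (power X 2))})
    : fps (coord_ring (power X k)) -> fps (coord_ring (power X k)) :=
  fps_ext (fun F l => leg i j (fps_coef l \o g) F).

Definition fps_flip (u : fps (coord_ring (power X 2)))
    : fps (coord_ring (power X 2)) :=
  fun l => flip (u l).

Definition quantum_YBE
    (g : {linear coord_ring (power X 2) -> fps (coord_ring (power X 2))}) :=
  let R12 := fps_leg (inord 0 : 'I_3) (inord 1) g in
  let R13 := fps_leg (inord 0 : 'I_3) (inord 2) g in
  let R23 := fps_leg (inord 1 : 'I_3) (inord 2) g in
  forall u : fps (coord_ring (power X 3)),
    R12 (R13 (R23 u)) = R23 (R13 (R12 u)).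

Definition geometric_quantum_Rmatrix
    (g : {linear coord_ring (power X 2) -> fps (coord_ring (power X 2))}) :=
  [/\ formal_diffeomorphism g, quantum_YBE g &
      forall u, fps_ext g (fps_flip (fps_ext g (fps_flip u))) = u].

(* g = 1 + h r + O(h^2) *)
Definition quantizes
    (g : {linear coord_ring (power X 2) -> fps (coord_ring (power X 2))})
    (r : {linear coord_ring (power X 2) -> coord_ring (power X 2)}) :=
  forall F, g F 0%N = F /\ g F 1%N = r F.

End RMatrices.

(* Main.v *)
Require Import Defs.
From HB Require Import structures.
From mathcomp Require Import all_boot all_order all_algebra.
From mathcomp Require Import boolp classical_sets functions reals.
From mathcomp Require Import complex mpoly.

(* By unitarity r_ij = f_ij - f_ji, where f_ij is the vector field on X^k that
   moves the i-th point only, with velocity depending on the i-th and the j-th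
   point; f_ii is its restriction to the diagonal. The classical Yang-Baxter
   equation says exactly that the column sums sum_i f_ij, for varying j,
   commute with each other. Put
     t_ij = exp(- h f_jj) exp(h (f_ij + f_jj)),     R = t_12 t_21^-1.
   On three points exp(h sum_i f_ij) = exp(h f_jj) t_ij t_kj, so commutation of
   the exponentials of the columns yields R_ij J_ijk = J_jik for
   J_ijk = t_kj t_ji t_ki, while R_jk J_ijk = J_ikj is immediate. Both sides of
   the quantum Yang-Baxter equation therefore carry J_123 to J_321. Identities
   between algebra homomorphisms are checked on coordinate functions, on which
   most of the operators act trivially. *)

Set Implicit Arguments.
Unset Strict Implicit.
Unset Printing Implicit Defensive.

Import GRing.Theory.
Local Open Scope ring_scope.

(** * Coordinate rings: generators and derivations *)

Section CoordinateRings.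
Context {K : fieldType} {m : nat} {Y : set 'rV[K]_m}.
Implicit Types F G : coord_ring Y.

Lemma coord_scalerAl (c : K) F G : c *: (F * G) = (c *: F) * G.
Proof. by apply: coordP => y; rewrite coordZE !coordME mulrA. Qed.

Lemma coord_scalerAr (c : K) F G : c *: (F * G) = F * (c *: G).
Proof. by rewrite mulrC coord_scalerAl mulrC. Qed.

Definition coord_cst (c : K) : coord_ring Y := c *: (1 : coord_ring Y).

Lemma coord_cstE c y : coord_cst c y = c.
Proof. by rewrite coordZE coord1E mulr1. Qed.

Lemma coord_cst0 : coord_cst 0 = 0. Proof. exact: scale0r. Qed.
Lemma coord_cst1 : coord_cst 1 = 1. Proof. exact: scale1r. Qed.

Lemma coord_cstM c F : coord_cst c * F = c *: F.
Proof. by rewrite -coord_scalerAl mul1r. Qed.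

Definition coordinate (l : 'I_m) : coord_ring Y := coord_of (regular_coordinate Y l).

(** A regular function is the restriction of a polynomial, and expanding the polynomial into
    monomials builds the function from constants and coordinates. *)
Lemma coord_ind (P : coord_ring Y -> Prop) :
    (forall c : K, P (coord_cst c)) -> (forall l, P (coordinate l)) ->
    (forall F G, P F -> P G -> P (F + G)) ->
    (forall F G, P F -> P G -> P (F * G)) ->
  forall F, P F.
Proof.
move=> PC Pl PD PM F; have [p Fp] := coord_regular F.
have P0 : P 0 by rewrite -coord_cst0; exact: PC.
have P1 : P 1 by rewrite -coord_cst1; exact: PC.
have -> : F = \sum_(mu <- msupp p) coord_cst p@_mu *
    \prod_(l < m) coordinate l ^+ mu l.
  apply: coordP => y; rewrite Fp mevalE coord_sumE; apply: eq_bigr => mu _.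
  rewrite coordME coord_cstE; congr (_ * _).
  have ex (G : coord_ring Y) k : (G ^+ k) y = G y ^+ k.
    by elim: k => // k IH; rewrite !exprS coordME IH.
  apply: (big_ind2 (fun a (G : coord_ring Y) => a = G y)) => //.
    by move=> a b G H -> ->; rewrite coordME.
apply: (big_ind P) => // mu _; apply: (PM) => //.
apply: (big_ind P P1 PM) => l _; elim: (mu l) => // k IH.
by rewrite exprS; apply: PM.
Qed.

(** A predicate on bare maps, so that negatives, sums and iterates can be handled without packing
    them as linear maps; linearity over [K] is recovered in [derivationZ]. *)
Definition is_derivation (D : coord_ring Y -> coord_ring Y) :=
  [/\ forall F G, D (F + G) = D F + D G,
      forall F G, D (F * G) = D F * G + F * D G &
      forall c : K, D (coord_cst c) = 0].

Section Derivations.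
Variable (D : coord_ring Y -> coord_ring Y).
Hypothesis derD : is_derivation D.

Lemma derivationZ (c : K) F : D (c *: F) = c *: D F.
Proof.
have [_ DM D0] := derD.
by rewrite -coord_cstM DM D0 mul0r add0r coord_cstM.
Qed.

Lemma derivation0 : D 0 = 0.
Proof. by have [_ _ D0] := derD; rewrite -{1}coord_cst0 D0. Qed.

Lemma derivation_sum (I : Type) (s : seq I) (E : I -> coord_ring Y) :
  D (\sum_(i <- s) E i) = \sum_(i <- s) D (E i).
Proof.
have [DD _ _] := derD; elim: s => [|i s IH]; first by rewrite !big_nil derivation0.
by rewrite !big_cons DD IH.
Qed.

Lemma derivationN : is_derivation (fun F => - D F).
Proof.
have [DD DM D0] := derD; split=> [F G|F G|c].
- by rewrite DD opprD.
- by rewrite DM opprD mulNr mulrN.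
- by rewrite D0 oppr0.
Qed.

End Derivations.

Lemma derivation_sums (I : Type) (s : seq I) (P : pred I)
    (E : I -> coord_ring Y -> coord_ring Y) :
  (forall i, is_derivation (E i)) ->
  is_derivation (fun F => \sum_(i <- s | P i) E i F).
Proof.
move=> dE; split=> [F G|F G|c].
- by rewrite -big_split; apply: eq_bigr => i _; have [->] := dE i.
- rewrite mulr_suml mulr_sumr -big_split /=; apply: eq_bigr => i _.
  by have [_ -> _] := dE i.
- by rewrite big1 // => i _; have [_ _ ->] := dE i.
Qed.

End CoordinateRings.

(** * Endomorphisms of the power series ring over a coordinate ring *)

Section FormalHom.
Context {K : fieldType} {m : nat} {Y : set 'rV[K]_m}.
Local Notation A := (coord_ring Y).
Implicit Types (u v : fps A) (F G : A).

Definition fps_const F : fps A := fun k => if k is 0%N then F else 0.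
Definition fps_var : fps A := fun k => (k == 1%N)%:R.
Definition fps_tail u : fps A := fun k => u k.+1.

Lemma fpsDE u v k : (u + v) k = u k + v k. Proof. by []. Qed.

Lemma fps_constM F u k : (fps_const F * u) k = F * u k.
Proof.
rewrite fpsME big_ord_recl /= subn0 big1 ?addr0 // => i _.
by rewrite /= mul0r.
Qed.

Lemma fps_varM0 u : (fps_var * u) 0%N = 0.
Proof. by rewrite fpsME big_ord1 /fps_var /= mul0r. Qed.

Lemma fps_varMS u k : (fps_var * u) k.+1 = u k.
Proof.
rewrite fpsME 2!big_ord_recl /fps_var /= mul0r add0r mul1r subSS subn0.
by rewrite big1 ?addr0 // => i _; rewrite mul0r.
Qed.

Lemma fps_decomp u : u = fps_const (u 0%N) + fps_var * fps_tail u.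
Proof.
apply/funext => -[|k]; rewrite fpsDE ?fps_varM0 ?fps_varMS /= ?addr0 //.
by rewrite add0r.
Qed.

Lemma fps_constD F G : fps_const (F + G) = fps_const F + fps_const G.
Proof. by apply/funext => -[|k]; rewrite fpsDE //= addr0. Qed.

Lemma fps_const_mul F G : fps_const (F * G) = fps_const F * fps_const G.
Proof. by apply/funext => -[|k]; rewrite fps_constM //= mulr0. Qed.

Lemma fps_const1 : fps_const 1 = 1.
Proof. by apply/funext => -[|k]. Qed.

Lemma fps_scaleE (c : K) u : c *: u = fps_const (coord_cst c) * u.
Proof. by apply/funext => k; rewrite fps_constM coord_cstM. Qed.

(** Fixing h forces [Phi] to commute with multiplication by powers of h, so h-adic continuity is
    automatic. *)
Definition fps_hom (Phi : fps A -> fps A) :=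
  [/\ forall u v, Phi (u + v) = Phi u + Phi v,
      forall u v, Phi (u * v) = Phi u * Phi v,
      forall c : K, Phi (fps_const (coord_cst c)) = fps_const (coord_cst c) &
      Phi fps_var = fps_var].

Lemma fps_hom_id : fps_hom id.
Proof. by []. Qed.

Lemma fps_hom_comp Phi Psi :
  fps_hom Phi -> fps_hom Psi -> fps_hom (fun u => Phi (Psi u)).
Proof.
move=> [PD PM PC PX] [QD QM QC QX]; split=> [u v|u v|c|].
- by rewrite QD PD.
- by rewrite QM PM.
- by rewrite QC PC.
- by rewrite QX PX.
Qed.

Lemma fps_hom1 Phi : fps_hom Phi -> Phi 1 = 1.
Proof. by case=> _ _ PC _; rewrite -fps_const1 -coord_cst1 PC. Qed.

Lemma fps_homZ Phi (c : K) u : fps_hom Phi -> Phi (c *: u) = c *: Phi u.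
Proof. by case=> _ PM PC _; rewrite !fps_scaleE PM PC. Qed.

(** Constant series are settled by [coord_ind]. For the others write u = u_0 + h u': coefficient k+1
    of the image of u involves only the image of u_0 and coefficient k of the image of u'. *)
Lemma fps_hom_eq Phi Psi : fps_hom Phi -> fps_hom Psi ->
    (forall l, Phi (fps_const (coordinate l)) =
               Psi (fps_const (coordinate l))) ->
  forall u, Phi u = Psi u.
Proof.
move=> [PD PM PC PX] [QD QM QC QX] eql.
have eqC F : Phi (fps_const F) = Psi (fps_const F).
  elim/(@coord_ind K m Y): F => // [c|F G EF EG|F G EF EG]; first by rewrite PC QC.
    by rewrite fps_constD PD QD EF EG.
  by rewrite fps_const_mul PM QM EF EG.
move=> u; apply/funext => k; elim: k u => [|k IH] u.
  by rewrite (fps_decomp u) PD QD PM QM eqC !fpsDE PX QX !fps_varM0.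
by rewrite (fps_decomp u) PD QD PM QM eqC !fpsDE PX QX !fps_varMS IH.
Qed.

Lemma fps_ext_decomp (g : A -> fps A) u : (forall k, g 0 k = 0) ->
  fps_ext g u = g (u 0%N) + fps_var * fps_ext g (fps_tail u).
Proof.
move=> g0; apply/funext => -[|k]; rewrite fpsDE ?fps_varM0 ?fps_varMS.
  by rewrite /fps_ext big_ord1 subnn addr0.
rewrite /fps_ext big_ord_recr /= subnn addrC; congr (_ + _).
by apply: eq_bigr => l _; rewrite /fps_tail subSn // -ltnS.
Qed.

Lemma fps_ext_const (g : A -> fps A) F : (forall k, g 0 k = 0) ->
  fps_ext g (fps_const F) = g F.
Proof.
move=> g0; apply/funext => k; rewrite /fps_ext big_ord_recr /= subnn.
rewrite big1 ?add0r // => l _; have := ltn_ord l.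
by rewrite -subn_gt0; case: (k - l)%N => //= j _; rewrite g0.
Qed.

Lemma fps_hom_ext (g : A -> fps A) :
    (forall F G, g (F + G) = g F + g G) ->
    (forall F G, g (F * G) = g F * g G) ->
    (forall c : K, g (coord_cst c) = fps_const (coord_cst c)) ->
  fps_hom (fps_ext g).
Proof.
move=> gD gM gC.
have g0 k : g 0 k = 0 by rewrite -coord_cst0 gC coord_cst0; case: k.
have eD u v : fps_ext g (u + v) = fps_ext g u + fps_ext g v.
  apply/funext => k; rewrite fpsDE /fps_ext -big_split; apply: eq_bigr => l _.
  by rewrite fpsDE gD.
split=> //.
- move=> u v; apply/funext => k.
  suff: forall l, (l <= k)%N -> fps_ext g (u * v) l = (fps_ext g u * fps_ext g v) l.
    by apply.
  elim: k u v => [|k IH] u v l.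
    rewrite leqn0 => /eqP ->.
    by rewrite fpsME /fps_ext !big_ord1 fpsME big_ord1 gM fpsME big_ord1.
  move=> lk.
  (* With u' and v' the tails, u v = u_0 v_0 + h (u_0 v' + u' v). The images satisfy the same
     identity, and the factor h lowers the order so that the induction hypothesis applies. *)
  have -> : u * v = fps_const (u 0%N * v 0%N) +
      fps_var * (fps_const (u 0%N) * fps_tail v + fps_tail u * v).
    rewrite {1}(fps_decomp u) mulrDl {1}(fps_decomp v) mulrDr -fps_const_mul.
    by rewrite -addrA; congr (_ + _); rewrite mulrDr !mulrA (mulrC _ fps_var).
  rewrite (fps_ext_decomp _ g0) !fpsDE /= fps_varM0 addr0 gM.
  have -> : fps_ext g u * fps_ext g v = g (u 0%N) * g (v 0%N) +
      fps_var * (fps_ext g (fps_const (u 0%N)) * fps_ext g (fps_tail v)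
                + fps_ext g (fps_tail u) * fps_ext g v).
    rewrite {1}(fps_ext_decomp u g0) mulrDl {1}(fps_ext_decomp v g0) mulrDr.
    rewrite -addrA fps_ext_const //; congr (_ + _).
    by rewrite mulrDr !mulrA (mulrC _ fps_var).
  rewrite fpsDE; congr (_ + _); case: l lk => [|l] lk; first by rewrite !fps_varM0.
  rewrite !fps_varMS fpsDE -!IH // -fpsDE -eD; congr (fps_ext g _ l).
  by apply/funext => j; rewrite [LHS]fpsDE /= add0r fps_varMS.
- by move=> c; rewrite fps_ext_const.
(* The series h has constant term 0 and tail 1. *)
- apply/funext => k; rewrite (fps_ext_decomp _ g0) fpsDE {1}/fps_var /= g0 add0r.
  case: k => [|k]; rewrite ?fps_varM0 // fps_varMS.
  have -> : fps_tail fps_var = fps_const (coord_cst 1).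
    by rewrite coord_cst1; apply/funext => -[|j].
  by rewrite fps_ext_const // gC coord_cst1; case: k.
Qed.

End FormalHom.

(** * Exponentials of derivations in characteristic zero *)

Section FormalExp.
Context {K : fieldType} {m : nat} {Y : set 'rV[K]_m}.
Hypothesis charK : [pchar K] =i pred0.
Local Notation A := (coord_ring Y).
Implicit Types (u v : fps A) (F G : A) (D : A -> A).

Definition divided_power D (k : nat) F : A := (k`!%:R)^-1 *: iter k D F.

(** The operator exp(h D). *)
Definition fps_exp D : fps A -> fps A :=
  fps_ext (fun F k => divided_power D k F).

Let natS_neq0 k : k.+1%:R != 0 :> K.
Proof. by rewrite (proj1 (pcharf0P K) charK). Qed.

Lemma iter_derivationD D k F G :
  is_derivation D -> iter k D (F + G) = iter k D F + iter k D G.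
Proof. by case=> DD _ _; elim: k => //= k ->; rewrite DD. Qed.

Lemma iter_derivationZ D k (c : K) F :
  is_derivation D -> iter k D (c *: F) = c *: iter k D F.
Proof. by move=> dD; elim: k => //= k ->; rewrite derivationZ. Qed.

Lemma divided_powerS D k F : is_derivation D ->
  D (divided_power D k F) = k.+1%:R *: divided_power D k.+1 F.
Proof.
move=> dD; rewrite derivationZ // scalerA; congr (_ *: _).
by rewrite factS natrM invfM mulrA mulfV // mul1r.
Qed.

Lemma divided_power0 D F : divided_power D 0 F = F.
Proof. by rewrite /divided_power fact0 invr1 scale1r. Qed.

(** The Leibniz rule for D^k/k!, which makes exp(h D) multiplicative. In the induction both sides
    are multiplied by k+1, nonzero in [K], because [D] applied to D^k/k! is k+1 times the next
    divided power. *)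
Lemma divided_powerM D k F G : is_derivation D ->
  divided_power D k (F * G) =
  \sum_(i < k.+1) divided_power D i F * divided_power D (k - i) G.
Proof.
move=> dD; have [_ DM _] := dD.
elim: k => [|k IH]; first by rewrite big_ord1 !divided_power0.
apply: (scalerI (natS_neq0 k)); rewrite -divided_powerS // IH derivation_sum //.
pose c (i : nat) := divided_power D i F * divided_power D (k.+1 - i) G.
transitivity (\sum_(i < k.+1) (i.+1%:R *: c i.+1 + (k.+1 - i)%:R *: c i)).
  apply: eq_bigr => i _; rewrite DM !divided_powerS // /c subSS.
  by rewrite (coord_scalerAl i.+1%:R) (coord_scalerAr (k.+1 - i)%:R) subSn // -ltnS.
rewrite big_split /= scaler_sumr.
(* The weight k+1 splits as i + (k+1-i); the boundary term added to each sum has weight 0. *)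
transitivity (\sum_(i < k.+2) i%:R *: c i + \sum_(i < k.+2) (k.+1 - i)%:R *: c i).
  rewrite [X in _ = X + _]big_ord_recl mulr0n scale0r add0r.
  by rewrite [X in _ = _ + X]big_ord_recr /= subnn mulr0n scale0r addr0.
rewrite -big_split; apply: eq_bigr => i _ /=.
by rewrite -scalerDl -natrD subnKC // -ltnS.
Qed.

Lemma fps_exp_hom D : is_derivation D -> fps_hom (fps_exp D).
Proof.
move=> dD; apply: fps_hom_ext => [F G|F G|c]; apply/funext => k.
- by rewrite /divided_power iter_derivationD // scalerDr.
- by rewrite divided_powerM.
- case: k => [|k]; first by rewrite divided_power0.
  rewrite /divided_power iterSr; have [_ _ ->] := dD.
  have -> : iter k D 0 = 0 by elim: k => //= k ->; rewrite derivation0.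
  by rewrite scaler0.
Qed.

Lemma divided_power_0 D k : is_derivation D -> divided_power D k 0 = 0.
Proof.
by move=> dD; rewrite /divided_power -{1}(scale0r 0) iter_derivationZ // scale0r scaler0.
Qed.

Lemma fps_exp_const D F : is_derivation D ->
  fps_exp D (fps_const F) = (fun k => divided_power D k F).
Proof. by move=> dD; apply: fps_ext_const => k; exact: divided_power_0. Qed.

Lemma fps_exp_id D u : is_derivation D -> (forall k, D (u k) = 0) -> fps_exp D u = u.
Proof.
move=> dD Du; apply/funext => k; rewrite /fps_exp /fps_ext big_ord_recl.
rewrite divided_power0 subn0 big1 ?addr0 // => i _.
rewrite /divided_power iterSr Du; have -> : iter (i : nat) D 0 = 0.
  by elim: (i : nat) => //= i' ->; rewrite derivation0.
by rewrite scaler0.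
Qed.

Lemma fps_exp_coef0 D u : fps_exp D u 0%N = u 0%N.
Proof. by rewrite /fps_exp /fps_ext big_ord1 divided_power0. Qed.

Lemma fps_exp_coef1 D u : fps_exp D u 1%N = u 1%N + D (u 0%N).
Proof.
rewrite /fps_exp /fps_ext big_ord_recl big_ord1 divided_power0 /=.
by rewrite /divided_power invr1 scale1r.
Qed.

(** On a coordinate F the coefficient of h^k is (1-1)^k D^k F / k! by the binomial theorem, so only
    k = 0 survives. *)
Lemma fps_expK D u : is_derivation D ->
  fps_exp D (fps_exp (fun F => - D F) u) = u.
Proof.
move=> dD; have dN := derivationN dD.
apply: (@fps_hom_eq _ _ _ (fun u => fps_exp D (fps_exp _ u)) id).
- by apply: fps_hom_comp; exact: fps_exp_hom.
- exact: fps_hom_id.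
move=> l; move: (coordinate l) => F; apply/funext => k.
rewrite (fps_exp_const F dN) /fps_exp /fps_ext.
have iN j : iter j (fun F => - D F) F = (-1) ^+ j *: iter j D F.
  elim: j => [|j IH]; first by rewrite scale1r.
  by rewrite !iterS IH derivationZ // exprS mulN1r scaleNr.
transitivity ((k`!%:R)^-1 *: ((1 - 1) ^+ k *: iter k D F)); last first.
  rewrite subrr; case: k => [|k]; last by rewrite expr0n scale0r scaler0.
  by rewrite invr1 !scale1r.
rewrite addrC exprDn scaler_suml scaler_sumr; apply: eq_bigr => i _.
have ik : (i <= k)%N by rewrite -ltnS.
rewrite /divided_power iN !scalerA iter_derivationZ // !scalerA -iterD subnKC //.
congr (_ *: _); rewrite expr1n mulr1 -[X in _ = _ * X]mulr_natl.
rewrite -(bin_fact ik) !natrM.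
have Cki : 'C(k, i)%:R != 0 :> K.
  by rewrite (proj1 (pcharf0P K) charK) -lt0n bin_gt0.
by rewrite invfM [RHS]mulrACA mulVf // mul1r invfM mulrA.
Qed.

(** On a coordinate both sides are sums of the terms D^i D'^j / (i! j!), matched by reversing the
    order of summation. *)
Lemma fps_exp_comm D D' u : is_derivation D -> is_derivation D' ->
    (forall F, D (D' F) = D' (D F)) ->
  fps_exp D (fps_exp D' u) = fps_exp D' (fps_exp D u).
Proof.
move=> dD dD' DD'.
apply: (@fps_hom_eq _ _ _ (fun u => fps_exp D (fps_exp D' u))
                          (fun u => fps_exp D' (fps_exp D u))).
- by apply: fps_hom_comp; exact: fps_exp_hom.
- by apply: fps_hom_comp; exact: fps_exp_hom.
move=> l; move: (coordinate l) => F; rewrite !fps_exp_const //.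
have cm i j G : iter i D (iter j D' G) = iter j D' (iter i D G).
  have c1 H : iter i D (D' H) = D' (iter i D H) by elim: i => //= i ->.
  by elim: j => //= j IH; rewrite c1 IH.
apply/funext => k; rewrite /fps_exp /fps_ext (reindex_inj rev_ord_inj) /=.
apply: eq_bigr => i _; have ik : (i <= k)%N by rewrite -ltnS.
rewrite subSS subKn //.
rewrite /divided_power !iter_derivationZ // !scalerA cm.
by congr (_ *: _); rewrite mulrC.
Qed.

End FormalExp.

(** * Exponentials on a class of functions stable under the derivation *)

Section ExpInvariants.
Context {K : fieldType} {m : nat} {Y : set 'rV[K]_m}.
Local Notation A := (coord_ring Y).
Variables (P : A -> Prop) (D D' : A -> A).
Hypothesis PD : forall F, P F -> P (D F).

(** The iterates of [D] never leave [P], so [D'] may replace [D] one step at a time. *)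
Lemma eq_fps_exp (u : fps A) :
  (forall F, P F -> D F = D' F) -> (forall k, P (u k)) ->
  fps_exp D u = fps_exp D' u.
Proof.
move=> DD' Pu; apply/funext => k; apply: eq_bigr => l _; congr (_ *: _).
have : P (u (k - l)%N) by [].
move: (u _) => F PF.
suff [] : iter l D F = iter l D' F /\ P (iter l D F) by [].
by elim: (l : nat) => //= j [<- Pj]; split; [exact: DD'|exact: PD].
Qed.

Lemma fps_exp_closed (u : fps A) : P 0 ->
    (forall F G, P F -> P G -> P (F + G)) -> (forall (c : K) F, P F -> P (c *: F)) ->
  (forall k, P (u k)) -> forall k, P (fps_exp D u k).
Proof.
move=> P0 PA PZ Pu k; apply: (big_ind P) => // l _; apply: PZ.
have : P (u (k - l)%N) by [].
by move: (u _) => F PF; elim: (l : nat) => //= j; exact: PD.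
Qed.

End ExpInvariants.

(** * Functions on the powers of X: coordinates and pullbacks *)

Section PowerFunctions.
Context {K : fieldType} {n : nat} {X : set 'rV[K]_n}.
Local Notation O k := (coord_ring (power X k)).

Definition power_coordinate k (a : 'I_k) (c : 'I_n) : O k :=
  coord_of (factor_regular X a c).

Lemma coordinate_power k (a : 'I_k) (c : 'I_n) :
  coordinate (mxvec_index a c) = power_coordinate a c.
Proof. by apply: coordP => v; rewrite /= mxE mxE. Qed.

Lemma power_ind k (P : O k -> Prop) :
    (forall c : K, P (coord_cst c)) -> (forall a c, P (power_coordinate a c)) ->
    (forall F G, P F -> P G -> P (F + G)) ->
    (forall F G, P F -> P G -> P (F * G)) ->
  forall F, P F.
Proof.
move=> PC Px PD PM; apply: coord_ind => // l.
by case/mxvec_indexP: l => a c; rewrite coordinate_power.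
Qed.

Lemma power_hom_eq k (Phi Psi : fps (O k) -> fps (O k)) :
    fps_hom Phi -> fps_hom Psi ->
    (forall a c, Phi (fps_const (power_coordinate a c)) =
                 Psi (fps_const (power_coordinate a c))) ->
  forall u, Phi u = Psi u.
Proof.
move=> hPhi hPsi eqx; apply: fps_hom_eq => // l.
by case/mxvec_indexP: l => a c; rewrite coordinate_power.
Qed.

Lemma power_eq k (v w : power X k) : (forall a, factor v a = factor w a) -> v = w.
Proof.
by move=> vw; rewrite -(factorK v) -(factorK w); congr of_factors; apply/funext.
Qed.

Lemma flipE (F : O 2) w : flip F w = F (swap w). Proof. by []. Qed.

Lemma legE k (i j : 'I_k) (T : {linear O 2 -> O 2}) F v :
  leg i j T F v = T (slice i j F v) (legs i j v).
Proof. by []. Qed.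

Section Pull.
Context {k l : nat} (sg : 'I_k -> 'I_l).

Definition reindex_factors (v : power X l) : power X k :=
  of_factors (fun b => factor v (sg b)).

Lemma pull_subproof (F : O k) : regular (power X l) (fun v => F (reindex_factors v)).
Proof.
apply: regular_comp => j; case/mxvec_indexP: j => a c.
under eq_fun do rewrite of_factors_coordE; exact: factor_regular.
Qed.

(** Repeated values of [sg] amount to restriction to a diagonal; [col_comm] relies on this. *)
Definition pull (F : O k) : O l := coord_of (pull_subproof F).

Lemma pullE F v : pull F v = F (reindex_factors v). Proof. by []. Qed.
Lemma pullD F G : pull (F + G) = pull F + pull G. Proof. exact: coordP. Qed.
Lemma pullM F G : pull (F * G) = pull F * pull G. Proof. exact: coordP. Qed.
Lemma pullZ (c : K) F : pull (c *: F) = c *: pull F. Proof. exact: coordP. Qed.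
Lemma pull_cst c : pull (coord_cst c) = coord_cst c. Proof. exact: coordP. Qed.
Lemma pull0 : pull 0 = 0. Proof. exact: coordP. Qed.

Lemma pull_coordinate a c : pull (power_coordinate a c) = power_coordinate (sg a) c.
Proof.
apply: coordP => v.
by rewrite [LHS]/(val (factor (reindex_factors v) a) 0 c) of_factorsK.
Qed.

Definition fps_pull (u : fps (O k)) : fps (O l) := fun j => pull (u j).

Lemma fps_pull_const F : fps_pull (fps_const F) = fps_const (pull F).
Proof. by apply/funext => -[|j] //; exact: pull0. Qed.

Lemma fps_exp_pull (D : O k -> O k) (D' : O l -> O l) u :
  (forall F, D' (pull F) = pull (D F)) ->
  fps_exp D' (fps_pull u) = fps_pull (fps_exp D u).
Proof.
move=> DD'; apply/funext => j; rewrite /fps_pull /fps_exp /fps_ext.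
rewrite (big_morph pull pullD pull0); apply: eq_bigr => i _.
rewrite /divided_power pullZ; congr (_ *: _).
by move: (u _) => F; elim: (i : nat) => //= i' ->.
Qed.

End Pull.

(** * Functions that do not depend on a given factor *)

Definition indep k (a : 'I_k) (F : O k) :=
  forall v w, (forall b, b != a -> factor v b = factor w b) -> F v = F w.

Lemma indep0 k (a : 'I_k) : indep a 0. Proof. by []. Qed.

Lemma indepD k (a : 'I_k) F G : indep a F -> indep a G -> indep a (F + G).
Proof. by move=> iF iG v w vw; rewrite !coordDE (iF v w) // (iG v w). Qed.

Lemma indepZ k (a : 'I_k) (c : K) F : indep a F -> indep a (c *: F).
Proof. by move=> iF v w vw; rewrite !coordZE (iF v w). Qed.

Lemma indep_coordinate k (a b : 'I_k) c : a != b -> indep a (power_coordinate b c).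
Proof.
move=> ab v w vw; rewrite [LHS]/(val (factor v b) 0 c).
by rewrite vw // eq_sym.
Qed.

Definition fps_indep k (a : 'I_k) (u : fps (O k)) := forall j, indep a (u j).

Lemma fps_indep_const k (a : 'I_k) F : indep a F -> fps_indep a (fps_const F).
Proof. by move=> aF [|j]. Qed.

(** * The vector fields f_ij and the commutation of their column sums *)

Section Columns.
Variable r : {linear O 2 -> O 2}.
Hypothesis derr : derivation r.

Lemma derivation_cst c : r (coord_cst c) = 0.
Proof.
have r1 : r 1 = 0.
  have := derr 1 1; rewrite !mulr1 mul1r => /eqP.
  by rewrite -[X in X == _]addr0 (inj_eq (addrI _)) eq_sym => /eqP.
by rewrite /coord_cst linearZ_LR r1 scaler0.
Qed.

(* The vector field f_ij; slicing at the single factor i allows i = j. *)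
Section Part.
Context {k : nat} (i j : 'I_k).

Lemma part_subproof (F : O k) :
  regular (power X k) (fun v => r (slice i i F v) (legs i j v)).
Proof.
have [s sP] := slice_split i i F.
suff -> : (fun v => r (slice i i F v) (legs i j v)) =
    ((\sum_(ab <- s) ab.1 * pull_legs i j (r ab.2)) : O k).
  exact: coord_regular.
apply/funext => v; rewrite sP linear_sum !coord_sumE.
by apply: eq_bigr => ab _; rewrite linearZ.
Qed.

Definition part (F : O k) : O k := coord_of (part_subproof F).

Lemma partE F v : part F v = r (slice i i F v) (legs i j v). Proof. by []. Qed.

Lemma set_leg_legs (v : power X k) : set_legs i i v (legs i j v) = v.
Proof.
apply: power_eq => a; rewrite of_factorsK.
by case: eqVneq => // ->; rewrite of_factorsK eqxx.
Qed.

Lemma part_derivation : is_derivation part.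
Proof.
split=> [F G|F G|c]; apply: coordP => v; rewrite ?coordDE ?coordME !partE.
- have -> : slice i i (F + G) v = slice i i F v + slice i i G v by exact: coordP.
  by rewrite linearD coordDE.
- have -> : slice i i (F * G) v = slice i i F v * slice i i G v by exact: coordP.
  have sE H : slice i i H v (legs i j v) = H v.
    by rewrite [LHS]/(H (set_legs i i v (legs i j v))) set_leg_legs.
  by rewrite derr coordDE !coordME !sE.
- have -> : slice i i (coord_cst c) v = coord_cst c by exact: coordP.
  by rewrite derivation_cst.
Qed.

(** Only the [i]-th point moves, so the slice is a constant, which [r] kills. *)
Lemma part_indep0 F : indep i F -> part F = 0.
Proof.
move=> iF; apply: coordP => v; rewrite partE.
have -> : slice i i F v = coord_cst (F v : K).
  apply: coordP => w; rewrite coord_cstE; apply: iF => b bi.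
  by rewrite of_factorsK !(negbTE bi).
by rewrite derivation_cst.
Qed.

(** The only new dependence that f_ij can create is on the [j]-th factor. For [c = i] the result is
    0; otherwise neither the slice nor the pair of legs changes with factor [c]. *)
Lemma part_indep c F : c != j -> indep c F -> indep c (part F).
Proof.
move=> cj cF; have [ci|ci] := eqVneq c i; first by rewrite part_indep0 // -ci.
move=> v w vw; rewrite !partE.
have -> : legs i j v = legs i j w.
  apply: power_eq => b; rewrite !of_factorsK.
  by apply: vw; case: ifP => _; rewrite eq_sym.
have -> // : slice i i F v = slice i i F w.
apply: coordP => t; apply: cF => b bc; rewrite !of_factorsK.
by case: (b == i) => //; exact: vw.
Qed.

Lemma part_coordinate c v :
  part (power_coordinate i c) v = r (power_coordinate ord0 c) (legs i j v).
Proof.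
rewrite partE; have -> // : slice i i (power_coordinate i c) v = power_coordinate ord0 c.
apply: coordP => w.
by rewrite [LHS]/(val (factor (set_legs i i v w) i) 0 c) of_factorsK eqxx.
Qed.

End Part.

(** The set [S] is a parameter so as to cover the complete columns as well as the partial ones f_jj
    and f_ij + f_jj that enter t_ij. *)
Definition column k (S : pred 'I_k) (j : 'I_k) (F : O k) : O k :=
  \sum_(i | S i) part i j F.

Lemma col_derivation k (S : pred 'I_k) j : is_derivation (column S j).
Proof. by apply: derivation_sums => i; exact: part_derivation. Qed.

Lemma col_indep k (S : pred 'I_k) j c F : c != j -> indep c F -> indep c (column S j F).
Proof.
move=> cj cF; apply: (big_ind (indep c)) => [||i _]; last exact: part_indep.
  exact: indep0.
by move=> G H; exact: indepD.
Qed.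

Lemma col_subset k (S S' : pred 'I_k) j F :
  (forall a, S a != S' a -> indep a F) -> column S j F = column S' j F.
Proof.
move=> SF; rewrite /column [LHS]big_mkcond [RHS]big_mkcond; apply: eq_bigr => a _.
have [<-//|/SF aF] := eqVneq (S a) (S' a).
by rewrite part_indep0 // !if_same.
Qed.

Lemma col_coordinate k (S : pred 'I_k) j a c :
  column S j (power_coordinate a c) =
  if S a then part a j (power_coordinate a c) else 0.
Proof.
rewrite /column big_mkcond (bigD1 a) //= big1 ?addr0 // => b ba.
by rewrite part_indep0 ?if_same //; exact: indep_coordinate.
Qed.

(** Both sides are derivations along the homomorphism [pull sg], hence determined by coordinates;
    there both evaluate the same velocity at the points [sg a] and [sg b]. *)
Lemma col_pull k l (sg : 'I_k -> 'I_l) (S : pred 'I_l) b F :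
  column S (sg b) (pull sg F) = pull sg (column (fun a => S (sg a)) b F).
Proof.
have [DD DM DC] := col_derivation S (sg b).
have [ED EM EC] := col_derivation (fun a => S (sg a)) b.
elim/(@power_ind k): F => [c|a c|F G IF IG|F G IF IG].
- by rewrite pull_cst DC EC pull0.
- rewrite pull_coordinate !col_coordinate; case: ifP => _; last by rewrite pull0.
  apply: coordP => v; rewrite part_coordinate.
  rewrite pullE part_coordinate; congr (r _ _); apply: power_eq => d.
  by rewrite !of_factorsK; case: ifP.
- by rewrite pullD DD ED pullD IF IG.
- by rewrite pullM DM EM pullD !pullM IF IG.
Qed.

Hypothesis unir : forall F, r F + flip (r (flip F)) = 0.

(** Both sides are derivations. On coordinates of point [i] the left side is f_ij by construction,
    on those of point [j] unitarity turns it into -f_ji, and all others are killed by both sides. *)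
Lemma leg_part k (i j : 'I_k) F : i != j -> leg i j r F = part i j F - part j i F.
Proof.
move=> ij; have [DD DM DC] := part_derivation i j.
have [ED EM EC] := part_derivation j i.
elim/(@power_ind k): F => [c|a c|F G IF IG|F G IF IG].
- rewrite DC EC subrr; apply: coordP => v.
  rewrite legE.
  have -> : slice i j (coord_cst c) v = coord_cst c by exact: coordP.
  by rewrite derivation_cst.
- apply: coordP => v.
  rewrite legE.
  have [ai|ai] := eqVneq a i.
    rewrite ai [part j i _]part_indep0 ?subr0; last first.
      by apply: indep_coordinate; rewrite eq_sym.
    rewrite part_coordinate; congr (r _ _); apply: coordP => w.
    by rewrite [LHS]/(val (factor (set_legs i j v w) i) 0 c) of_factorsK eqxx.
  have [aj|aj] := eqVneq a j.
    rewrite aj [part i j _]part_indep0 ?sub0r ?coordNE; last exact: indep_coordinate.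
    rewrite part_coordinate.
    have -> : slice i j (power_coordinate j c) v = flip (power_coordinate ord0 c).
      apply: coordP => w.
      rewrite [LHS]/(val (factor (set_legs i j v w) j) 0 c) of_factorsK.
      rewrite eq_sym (negbTE ij) eqxx.
      rewrite [RHS]/(val (factor (swap w) ord0) 0 c) of_factorsK.
      by congr (val (factor w _) 0 c); apply: val_inj.
    have flipK (F : O 2) : flip (flip F) = F.
      apply: coordP => w; rewrite !flipE; congr (F _).
      by apply: power_eq => b; rewrite !of_factorsK rev_ordK.
    move/eqP: (unir (flip (power_coordinate ord0 c))).
    rewrite flipK addr_eq0 => /eqP ->.
    rewrite coordNE; congr (- _).
    rewrite flipE; congr (r _ _).
    apply: power_eq => b; rewrite !of_factorsK.
    by case: b => [[|[|]]].
  rewrite !part_indep0; try by apply: indep_coordinate; rewrite eq_sym.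
  have -> : slice i j (power_coordinate a c) v = coord_cst (power_coordinate a c v : K).
    apply: coordP => w; rewrite coord_cstE.
    rewrite [LHS]/(val (factor (set_legs i j v w) a) 0 c) of_factorsK.
    by rewrite (negbTE ai) (negbTE aj).
  by rewrite derivation_cst subrr.
- have -> : leg i j r (F + G) = leg i j r F + leg i j r G.
    apply: coordP => v; rewrite coordDE.
    rewrite legE.
    have -> : slice i j (F + G) v = slice i j F v + slice i j G v by exact: coordP.
    by rewrite linearD.
  by rewrite DD ED IF IG opprD addrACA.
- have -> : leg i j r (F * G) = leg i j r F * G + F * leg i j r G.
    apply: coordP => v; rewrite coordDE !coordME.
    rewrite legE.
    have -> : slice i j (F * G) v = slice i j F v * slice i j G v by exact: coordP.
    have sE H : slice i j H v (legs i j v) = H v.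
      rewrite [LHS]/(H (set_legs i j v (legs i j v))); congr (H _).
      apply: power_eq => a; rewrite !of_factorsK /=.
      by case: eqVneq => [->//|_]; case: eqVneq => [->//|].
    by rewrite derr coordDE !coordME !sE.
  rewrite IF IG DM EM mulrBl mulrBr.
  by rewrite opprD addrACA.
Qed.

Hypothesis cybe : classical_YBE r.

(** For a coordinate x of point 0 most terms of the classical Yang-Baxter equation vanish by
    independence, leaving f_01 f_02 x - f_02 f_01 x - f_12 f_01 x + f_21 f_02 x = 0. This is the
    claim, since f_11 kills f_02 x and f_22 kills f_01 x. *)
Lemma col_comm3 c :
  let o0 := inord 0 : 'I_3 in let o1 := inord 1 : 'I_3 in let o2 := inord 2 : 'I_3 in
  column predT o1 (column predT o2 (power_coordinate o0 c)) =
  column predT o2 (column predT o1 (power_coordinate o0 c)).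
Proof.
move=> o0 o1 o2.
have n01 : o0 != o1 by rewrite -val_eqE /= !inordK.
have n02 : o0 != o2 by rewrite -val_eqE /= !inordK.
have n12 : o1 != o2 by rewrite -val_eqE /= !inordK.
have n10 : o1 != o0 by rewrite eq_sym.
have n20 : o2 != o0 by rewrite eq_sym.
have n21 : o2 != o1 by rewrite eq_sym.
set x := power_coordinate o0 c.
have x1 : indep o1 x by exact: indep_coordinate.
have x2 : indep o2 x by exact: indep_coordinate.
have a1 : indep o1 (part o0 o2 x) by exact: part_indep.
have a2 : indep o2 (part o0 o1 x) by exact: part_indep.
have colE F j : column predT j F = part o0 j F + (part o1 j F + part o2 j F).
  rewrite /column !big_ord_recl big_ord0 addr0.
  by congr (part _ _ _ + (part _ _ _ + part _ _ _)); apply: val_inj; rewrite /= inordK.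
have := cybe x; rewrite /commutator -/o0 -/o1 -/o2 !leg_part //.
rewrite !(part_indep0 _ x1) !(part_indep0 _ x2) !subr0.
have p0 (i j : 'I_3) : part i j 0 = 0 by apply: part_indep0.
rewrite !p0 !(part_indep0 _ a1) !(part_indep0 _ a2) !subr0 !sub0r => E.
rewrite !col_coordinate /= -/x !colE !(part_indep0 _ a1) !(part_indep0 _ a2).
rewrite !(add0r, addr0); apply/eqP; rewrite -subr_eq0 -[X in _ == X]E; apply/eqP.
by rewrite opprK opprD addrACA !addrA addrAC.
Qed.

Lemma col_comm k (S : pred 'I_k) (j j' : 'I_k) F : S j -> S j' ->
  column S j (column S j' F) = column S j' (column S j F).
Proof.
move=> Sj Sj'; have [DD DM DC] := col_derivation S j.
have [ED EM EC] := col_derivation S j'.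
elim/(@power_ind k): F => [c|a c|F G IF IG|F G IF IG].
- by rewrite DC EC !derivation0 //; exact: col_derivation.
- have [Sa|Sa] := boolP (S a); last first.
    rewrite !col_coordinate (negbTE Sa) !derivation0 //; exact: col_derivation.
  (* The points [a], [j], [j'] all lie in [S] but may coincide. Pulling back along 0, 1, 2 to [a],
     [j], [j'] reduces to complete columns on three points, diagonals included. *)
  pose sg (b : 'I_3) := nth a [:: a; j; j'] b.
  have -> : power_coordinate a c = pull sg (power_coordinate (inord 0) c).
    by rewrite pull_coordinate /sg inordK.
  have sg1 : j = sg (inord 1) by rewrite /sg inordK.
  have sg2 : j' = sg (inord 2) by rewrite /sg inordK.
  have Ssg : (fun b => S (sg b)) = predT.
    by apply/funext => -[[|[|[|b]]] blt].
  by rewrite sg1 sg2 !col_pull Ssg col_comm3.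
- by rewrite !(DD, ED) IF IG.
(* The two mixed products of first derivatives occur in both orders of composition. *)
- rewrite !(DM, EM, DD, ED) IF IG -!addrA; congr (_ + _).
  by rewrite addrCA.
Qed.

End Columns.
End PowerFunctions.

(** * Exponentials of columns and the twists t_ij *)

Section Twist.
Context {K : fieldType} {n : nat} {X : set 'rV[K]_n}.
Hypothesis charK : [pchar K] =i pred0.
Local Notation O k := (coord_ring (power X k)).
Variable r : {linear O 2 -> O 2}.
Hypothesis hr : geometric_classical_rmatrix r.

Let derr : derivation r. Proof. by case: hr. Qed.

Definition col_exp k (S : pred 'I_k) (j : 'I_k) := fps_exp (column r S j).
Definition col_expV k (S : pred 'I_k) (j : 'I_k) := fps_exp (fun F => - column r S j F).

Lemma col_exp_hom k (S : pred 'I_k) j : fps_hom (col_exp S j).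
Proof. by apply: fps_exp_hom => //; exact: col_derivation. Qed.

Lemma col_expV_hom k (S : pred 'I_k) j : fps_hom (col_expV S j).
Proof. by apply: fps_exp_hom => //; apply: derivationN; exact: col_derivation. Qed.

Lemma col_expVK k (S : pred 'I_k) j u : col_exp S j (col_expV S j u) = u.
Proof. by apply: fps_expK => //; exact: col_derivation. Qed.

Lemma col_expK k (S : pred 'I_k) j u : col_expV S j (col_exp S j u) = u.
Proof.
rewrite /col_exp; have -> : column r S j = (fun F => - - column r S j F).
  by apply/funext => F; rewrite opprK.
by apply: fps_expK => //; apply: derivationN; exact: col_derivation.
Qed.

Lemma indepN k (a : 'I_k) (F : O k) : indep a F -> indep a (- F).
Proof. by rewrite -scaleN1r; exact: indepZ. Qed.

Lemma col_exp_indep k (S : pred 'I_k) j a u :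
  a != j -> fps_indep a u -> fps_indep a (col_exp S j u).
Proof.
move=> aj au; apply: (fps_exp_closed (P := indep a)) => //.
- by move=> F; exact: col_indep.
- exact: indepD.
- by move=> c F; exact: indepZ.
Qed.

Lemma col_expV_indep k (S : pred 'I_k) j a u :
  a != j -> fps_indep a u -> fps_indep a (col_expV S j u).
Proof.
move=> aj au; apply: (fps_exp_closed (P := indep a)) => //.
- by move=> F aF; apply: indepN; exact: col_indep.
- exact: indepD.
- by move=> c F; exact: indepZ.
Qed.

(** A point of which [u] is independent stays absent from all iterates unless it is [j], so its
    membership in the index set is immaterial. *)
Lemma col_exp_subset k (S S' : pred 'I_k) j u :
    (forall a, S a != S' a -> a != j /\ fps_indep a u) ->
  col_exp S j u = col_exp S' j u.
Proof.
move=> SS'; apply: (eq_fps_exp (P := fun F => forall a, S a != S' a -> indep a F)).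
- by move=> F SF a Sa; apply: col_indep; [|by have [] := SS' a Sa|exact: SF].
- by move=> F SF; exact: col_subset.
- by move=> l a Sa; have [_] := SS' a Sa; exact.
Qed.

Lemma col_exp_pull k l (sg : 'I_k -> 'I_l) (S : pred 'I_l) (S' : pred 'I_k) b u :
  (forall a, S (sg a) = S' a) ->
  col_exp S (sg b) (fps_pull sg u) = fps_pull sg (col_exp S' b u).
Proof.
move=> SS'; apply: fps_exp_pull => F; rewrite col_pull //.
by congr pull; rewrite /column; apply: eq_bigl.
Qed.

Lemma col_expV_pull k l (sg : 'I_k -> 'I_l) (S : pred 'I_l) (S' : pred 'I_k) b u :
  (forall a, S (sg a) = S' a) ->
  col_expV S (sg b) (fps_pull sg u) = fps_pull sg (col_expV S' b u).
Proof.
move=> SS'; apply: fps_exp_pull => F; rewrite col_pull //.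
apply: coordP => v; rewrite coordNE !pullE coordNE; congr (- (_ : O k) _).
by rewrite /column; apply: eq_bigl.
Qed.

Lemma col_exp_comm k (S : pred 'I_k) j j' u : S j -> S j' ->
  col_exp S j (col_exp S j' u) = col_exp S j' (col_exp S j u).
Proof.
move=> Sj Sj'; have [_ cybe unir] := hr.
apply: fps_exp_comm => //; try exact: col_derivation.
by move=> F; exact: col_comm.
Qed.

Definition twist k (i j : 'I_k) u :=
  col_expV (pred1 j) j (col_exp (pred2 i j) j u).
Definition twistV k (i j : 'I_k) u :=
  col_expV (pred2 i j) j (col_exp (pred1 j) j u).

Lemma twistK k (i j : 'I_k) u : twistV i j (twist i j u) = u.
Proof. by rewrite /twist /twistV col_expVK col_expK. Qed.

Lemma twistVK k (i j : 'I_k) u : twist i j (twistV i j u) = u.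
Proof. by rewrite /twist /twistV col_expVK col_expK. Qed.

Lemma twist_hom k (i j : 'I_k) : fps_hom (twist i j).
Proof. by apply: fps_hom_comp; [exact: col_expV_hom|exact: col_exp_hom]. Qed.

Lemma twistV_hom k (i j : 'I_k) : fps_hom (twistV i j).
Proof. by apply: fps_hom_comp; [exact: col_expV_hom|exact: col_exp_hom]. Qed.

(** On such series f_ij acts by zero throughout, and the two exponentials of f_jj cancel. *)
Lemma twist_id k (i j : 'I_k) u : i != j -> fps_indep i u -> twist i j u = u.
Proof.
move=> ij iu; rewrite /twist (@col_exp_subset _ _ (pred1 j)) ?col_expK // => a /=.
by have [->|ai] := eqVneq a i; last by rewrite /= eqxx.
Qed.

Lemma twistV_id k (i j : 'I_k) u : i != j -> fps_indep i u -> twistV i j u = u.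
Proof. by move=> ij iu; rewrite -{1}(twist_id ij iu) twistK. Qed.

Lemma twist_indep k (i j a : 'I_k) u :
  a != j -> fps_indep a u -> fps_indep a (twist i j u).
Proof. by move=> aj au; apply: col_expV_indep => //; exact: col_exp_indep. Qed.

(** Injectivity ensures that no factor other than [i] and [j] is sent into the index set of the
    twist. *)
Lemma twist_pull k l (sg : 'I_k -> 'I_l) i j u : injective sg ->
  twist (sg i) (sg j) (fps_pull sg u) = fps_pull sg (twist i j u).
Proof.
move=> sg_inj; rewrite /twist (@col_exp_pull _ _ _ _ (pred2 i j)).
  by rewrite (@col_expV_pull _ _ _ _ (pred1 j)) // => a; rewrite /= inj_eq.
by move=> a; rewrite /= !inj_eq.
Qed.

Lemma twistV_pull k l (sg : 'I_k -> 'I_l) i j u : injective sg ->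
  twistV (sg i) (sg j) (fps_pull sg u) = fps_pull sg (twistV i j u).
Proof. by move=> sg_inj; rewrite -{1}(twistVK i j u) -twist_pull // twistK. Qed.

(** * Relations between twists at three distinct points *)

Section ThreeFactors.
Context {k : nat} (i j l : 'I_k).
Hypothesis ijl : uniq [:: i; j; l].

Let ij : i != j. Proof. by move: ijl; rewrite /= !inE; case: eqVneq. Qed.
Let il : i != l.
Proof. by move: ijl; rewrite /= !inE negb_or => /andP[/andP[]]. Qed.
Let jl : j != l. Proof. by move: ijl; rewrite /= !inE andbT => /andP[]. Qed.
Let ji : j != i. Proof. by rewrite eq_sym. Qed.
Let li : l != i. Proof. by rewrite eq_sym. Qed.
Let lj : l != j. Proof. by rewrite eq_sym. Qed.

Let indepx (a b : 'I_k) c :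
  a != b -> fps_indep a (fps_const (power_coordinate b c : O k)).
Proof. by move=> ab; apply: fps_indep_const; exact: indep_coordinate. Qed.

(** On a coordinate of point [i], t_lj is the identity both before and after t_ij; on every other
    coordinate the roles are exchanged. *)
Lemma twist_comm u : twist i j (twist l j u) = twist l j (twist i j u).
Proof.
apply: (@power_hom_eq _ _ _ _ (fun u => twist i j (twist l j u))
                              (fun u => twist l j (twist i j u))).
- by apply: fps_hom_comp; exact: twist_hom.
- by apply: fps_hom_comp; exact: twist_hom.
move=> a c; have [->|ai] := eqVneq a i.
  have xl : fps_indep l (fps_const (power_coordinate i c : O k)) by exact: indepx.
  by rewrite (twist_id lj xl) (twist_id lj (twist_indep i lj xl)).
have xi : fps_indep i (fps_const (power_coordinate a c : O k)).
  by apply: indepx; rewrite eq_sym.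
by rewrite (twist_id ij xi) (twist_id ij (twist_indep l ij xi)).
Qed.

Lemma col_exp_twist u :
  col_exp (pred3 i j l) j u = col_exp (pred1 j) j (twist i j (twist l j u)).
Proof.
apply: (@power_hom_eq _ _ _ _ (col_exp (pred3 i j l) j)
   (fun u => col_exp (pred1 j) j (twist i j (twist l j u)))).
- exact: col_exp_hom.
- apply: fps_hom_comp; first exact: col_exp_hom.
  by apply: fps_hom_comp; exact: twist_hom.
move=> a c; have [->|ai] := eqVneq a i.
  rewrite (twist_id lj) ?col_expVK; last exact: indepx.
  apply: col_exp_subset => b /=; have [->|bl] := eqVneq b l.
    by move=> _; split=> //; exact: indepx.
  by rewrite orbF eqxx.
have xi : fps_indep i (fps_const (power_coordinate a c : O k)).
  by apply: indepx; rewrite eq_sym.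
rewrite (twist_id ij) ?col_expVK; last exact: twist_indep.
apply: col_exp_subset => b /=; have [->//|bi] := eqVneq b i.
by rewrite orFb orbC eqxx.
Qed.

(** The two operators concern disjoint sets of points, [j] on one side and [i], [l] on the other, so
    on each coordinate one of them is the identity. *)
Lemma col_exp1_twist u :
  col_exp (pred1 j) j (twist l i u) = twist l i (col_exp (pred1 j) j u).
Proof.
apply: (@power_hom_eq _ _ _ _ (fun u => col_exp (pred1 j) j (twist l i u))
                              (fun u => twist l i (col_exp (pred1 j) j u))).
- by apply: fps_hom_comp; [exact: col_exp_hom|exact: twist_hom].
- by apply: fps_hom_comp; [exact: twist_hom|exact: col_exp_hom].
move=> a c; have [->|aj] := eqVneq a j.
  have xl : fps_indep l (fps_const (power_coordinate j c : O k)) by exact: indepx.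
  by rewrite (twist_id li xl) (twist_id li (col_exp_indep (pred1 j) lj xl)).
have xj : fps_indep j (fps_const (power_coordinate a c : O k)).
  by apply: indepx; rewrite eq_sym.
have qid u' : fps_indep j u' -> col_exp (pred1 j) j u' = u'.
  move=> ju; apply: fps_exp_id; first exact: col_derivation.
  by move=> d; rewrite (@col_subset _ _ _ _ _ _ _ pred0) ?/column ?big_pred0 // => b;
    rewrite /= eqbF_neg negbK => /eqP ->.
by rewrite !qid //; exact: twist_indep.
Qed.

End ThreeFactors.

(* The action of R in the factors i and j. *)
Definition exchange k (i j : 'I_k) (u : fps (O k)) := twist i j (twistV j i u).

Lemma exchange_hom k (i j : 'I_k) : fps_hom (exchange i j).
Proof. by apply: fps_hom_comp; [exact: twist_hom|exact: twistV_hom]. Qed.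

(** * The quantum Yang-Baxter equation *)

Section YangBaxter.
Context {k : nat}.
Implicit Types a b c : 'I_k.

(** This is R_ab J_abc = J_bac, the relation that uses the commutation of complete columns. *)
Lemma exchange_twist a b c u : uniq [:: a; b; c] ->
  exchange a b (twist c b (twist b a (twist c a u))) =
  twist c a (twist a b (twist c b u)).
Proof.
move=> abc; have bac : uniq [:: b; a; c].
  by move: abc; rewrite /= !inE !negb_or (eq_sym b a) => /and3P[/andP[-> ->] ->].
set w2 := twist c b _; set w1 := twist c a _.
have p2 : pred2 b a = pred2 a b :> pred 'I_k.
  by apply/funext => d; rewrite /= orbC.
have p3 : pred3 b a c = pred3 a b c :> pred 'I_k.
  by apply/funext => d; rewrite /= orbCA.
(* The exponentials of columns [a] and [b] over the three points are factored and composed in both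
   orders. Moving the diagonal exponentials past t_ca and t_cb leaves [w1] = J_bac and [w2] =
   J_abc. *)
have E : col_exp (pred2 a b) a (col_exp (pred1 b) b w1) =
         col_exp (pred2 a b) b (col_exp (pred1 a) a w2).
  have := @col_exp_comm _ (pred3 a b c) a b u.
  rewrite /= !eqxx /= orbT => /(_ isT isT).
  rewrite -{1 4}p3 !(col_exp_twist bac) !(col_exp_twist abc).
  rewrite -(col_exp1_twist abc) -(col_exp1_twist bac).
  by rewrite -/w1 -/w2 /twist !col_expVK p2.
(* The columns over [a] and [b] alone commute as well, so one exponential commutes with the inverse
   of the other. *)
have comm z : col_exp (pred2 a b) b (col_expV (pred2 a b) a z) =
              col_expV (pred2 a b) a (col_exp (pred2 a b) b z).
  rewrite -{2}(col_expVK (pred2 a b) a z) col_exp_comm ?col_expK //= eqxx //.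
  exact: orbT.
by rewrite /exchange {1}/twist /twistV p2 comm -E !col_expK.
Qed.

Lemma exchange_YBE a b c u : uniq [:: a; b; c] ->
  exchange a b (exchange a c (exchange b c u)) =
  exchange b c (exchange a c (exchange a b u)).
Proof.
move=> abc.
(* This is R_bc J_abc = J_acb: the factor t_cb cancels against its inverse in R_bc, and t_ba
   commutes with t_ca. *)
have A a' b' c' w : uniq [:: a'; b'; c'] ->
    exchange b' c' (twist c' b' (twist b' a' (twist c' a' w))) =
    twist b' c' (twist c' a' (twist b' a' w)).
  move=> abc'; rewrite /exchange twistK; congr twist.
  apply: twist_comm; move: abc'; rewrite /= !inE !negb_or (eq_sym b' a').
  by move=> /and3P[/andP[-> ->] ->].
have [acb cab bac bca] : [/\ uniq [:: a; c; b], uniq [:: c; a; b],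
    uniq [:: b; a; c] & uniq [:: b; c; a]].
  move: abc; rewrite /= !inE !negb_or (eq_sym c b) (eq_sym b a) (eq_sym c a).
  by move=> /and3P[/andP[-> ->] ->].
(* As J_abc is invertible, [u] can be written J_abc w; both sides then become J_cba w. *)
rewrite -(twistVK c b u) -(twistVK b a (twistV c b u)).
rewrite -(twistVK c a (twistV b a _)).
move: (twistV c a _) => w.
rewrite (A a b c w abc) (exchange_twist w acb) (A c a b w cab).
by rewrite (exchange_twist w abc) (A b a c w bac) (exchange_twist w bca).
Qed.

End YangBaxter.

(** * The quantum R-matrix on two factors and its first-order term *)

Section Quantization.
Local Notation o0 := (ord0 : 'I_2).
Local Notation o1 := (ord_max : 'I_2).

Definition quantum_fun (F : O 2) : fps (O 2) := exchange o0 o1 (fps_const F).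

Lemma quantum_fun_linear : linear quantum_fun.
Proof.
move=> c F G; have hR := exchange_hom o0 o1; have [RD _ _ _] := hR.
rewrite /quantum_fun fps_constD RD -fps_homZ //; congr (exchange _ _ _ + _).
by apply/funext => -[|k] //; rewrite [RHS]scaler0.
Qed.

HB.instance Definition _ :=
  GRing.isLinear.Build K (O 2) (fps (O 2)) _ quantum_fun quantum_fun_linear.

Lemma quantum_fun_morphism : monoid_morphism quantum_fun.
Proof.
have hR := exchange_hom o0 o1; have [_ RM _ _] := hR.
split; first by rewrite /quantum_fun fps_const1 fps_hom1.
by move=> F G; rewrite /quantum_fun fps_const_mul RM.
Qed.

Lemma quantum_fun_cst c : quantum_fun (coord_cst c) = fps_const (coord_cst c).
Proof. by have [_ _ RC _] := exchange_hom o0 o1; exact: RC. Qed.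

Lemma fps_ext_quantum u : fps_ext quantum_fun u = exchange o0 o1 u.
Proof.
have [g1 gM] := quantum_fun_morphism.
apply: fps_hom_eq.
- apply: fps_hom_ext => // [F G|c]; [exact: linearD|exact: quantum_fun_cst].
- exact: exchange_hom.
- by move=> l; rewrite fps_ext_const // => k; rewrite (linear0 quantum_fun).
Qed.

(** Both sides are endomorphisms of the series ring, so coordinates suffice. Those of points [i] and
    [j] are pulled back from two factors, where [quantum_fun] is the exchange by definition; the
    others are fixed by both sides. *)
Lemma fps_leg_quantum k (i j : 'I_k) u : i != j ->
  fps_leg i j quantum_fun u = exchange i j u.
Proof.
move=> ij; have [g1 gM] := quantum_fun_morphism.
have ji : j != i by rewrite eq_sym.
pose G (F : O k) l := leg i j (fps_coef l \o quantum_fun) F.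
have GE F l v : G F l v = quantum_fun (slice i j F v) l (legs i j v) by [].
have GC c : G (coord_cst c) = fps_const (coord_cst c).
  apply/funext => l; apply: coordP => v; rewrite GE.
  have -> : slice i j (coord_cst c) v = coord_cst c by exact: coordP.
  by rewrite quantum_fun_cst; case: l.
have G0 l : G 0 l = 0 by rewrite -coord_cst0 GC coord_cst0; case: l.
have hG : fps_hom (fps_ext G).
  apply: fps_hom_ext => // F H; apply/funext => l; apply: coordP => v.
    rewrite coordDE !GE.
    have -> : slice i j (F + H) v = slice i j F v + slice i j H v by exact: coordP.
    by rewrite linearD.
  rewrite GE.
  have -> : slice i j (F * H) v = slice i j F v * slice i j H v by exact: coordP.
  by rewrite gM !fpsME !coord_sumE.
apply: (@power_hom_eq _ _ _ _ (fps_ext G)) => //; first exact: exchange_hom.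
move=> a c; rewrite fps_ext_const //.
(* Injective because [i] and [j] differ, as the naturality of twists under [pull] requires. *)
pose sg (b : 'I_2) := if b == o0 then i else j.
have sg_inj : injective sg.
  move=> b b'; rewrite /sg; case: eqVneq => [->|b0]; case: eqVneq => [->|b'0] //.
  - by move/eqP; rewrite (negbTE ij).
  - by move/eqP; rewrite (negbTE ji).
  - by move=> _; apply: val_inj; case: b b0 => [[|[|]]] //; case: b' b'0 => [[|[|]]].
have Gpull F : G (pull sg F) = exchange i j (fps_const (pull sg F)).
  rewrite -fps_pull_const.
  rewrite /exchange -[X in twist X _]/(sg o0) -[X in twistV X]/(sg o1).
  rewrite -[X in twist _ X]/(sg o1) -[X in twistV _ X]/(sg o0).
  rewrite twistV_pull // twist_pull //; apply/funext => l; apply: coordP => v.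
  rewrite GE [RHS]/(quantum_fun F l (legs i j v)); congr (quantum_fun _ _ _).
  apply: coordP => w; rewrite [LHS]/(F (reindex_factors sg (set_legs i j v w))).
  congr (F _); apply: power_eq => b; rewrite !of_factorsK /sg.
  case: b => [[|[|]]] //= p; rewrite ?eqxx ?(negbTE ji); congr factor; exact: val_inj.
have [ai|ai] := eqVneq a i.
  by have := Gpull (power_coordinate o0 c); rewrite pull_coordinate ai.
have [aj|aj] := eqVneq a j.
  by have := Gpull (power_coordinate o1 c); rewrite pull_coordinate aj.
have xi : fps_indep i (fps_const (power_coordinate a c : O k)).
  by apply: fps_indep_const; apply: indep_coordinate; rewrite eq_sym.
have xj : fps_indep j (fps_const (power_coordinate a c : O k)).
  by apply: fps_indep_const; apply: indep_coordinate; rewrite eq_sym.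
rewrite /exchange (twistV_id ji xj) (twist_id ij xi).
apply/funext => l; apply: coordP => v; rewrite GE.
have -> : slice i j (power_coordinate a c) v = coord_cst (power_coordinate a c v : K).
  apply: coordP => w; rewrite coord_cstE.
  rewrite [LHS]/(val (factor (set_legs i j v w) a) 0 c) of_factorsK.
  by rewrite (negbTE ai) (negbTE aj).
by rewrite quantum_fun_cst; case: l => [|l] //; rewrite [LHS]coord_cstE.
Qed.

(** The flip is the pullback along the transposition, so conjugating R = t_12 t_21^-1 by it gives
    t_21 t_12^-1, the inverse. *)
Lemma exchange_unitary u :
  exchange o0 o1 (fps_flip (exchange o0 o1 (fps_flip u))) = u.
Proof.
have flipE (w : fps (O 2)) : fps_flip w = fps_pull (@rev_ord 2) w.
  by apply/funext => l; apply: coordP.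
have inj := @rev_ord_inj 2.
have r0 : rev_ord o1 = o0 by exact: val_inj.
have r1 : rev_ord o0 = o1 by exact: val_inj.
rewrite !flipE /exchange -twist_pull // -twistV_pull // r0 r1.
rewrite twistK twistVK; apply/funext => l; apply: coordP => v.
rewrite /fps_pull !pullE; congr (u l _).
by apply: power_eq => b; rewrite !of_factorsK rev_ordK.
Qed.

Lemma quantum_fun_coef0 F : quantum_fun F 0%N = F.
Proof.
by rewrite /quantum_fun /exchange /twist /twistV /col_exp /col_expV !fps_exp_coef0.
Qed.

(** With points numbered 0 and 1, the four exponentials contribute -f_11, f_01 + f_11, -(f_10 +
    f_00) and f_00, whose sum is f_01 - f_10. *)
Lemma quantum_fun_coef1 F : quantum_fun F 1%N = r F.
Proof.
have [_ _ unir] := hr.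
rewrite /quantum_fun /exchange /twist /twistV /col_exp /col_expV.
rewrite !fps_exp_coef1 !fps_exp_coef0 /= add0r.
have p1 (j : 'I_2) : column r (pred1 j) j F = part r j j F by exact: big_pred1_eq.
have p2 (i j : 'I_2) : i != j ->
    column r (pred2 i j) j F = part r i j F + part r j j F.
  move=> ij; rewrite /column (bigD1 i) /= ?eqxx //; congr (_ + _).
  rewrite (big_pred1 j) // => a /=; case: (eqVneq a j) => [->|aj].
    by rewrite orbT eq_sym.
  by rewrite orbF andbN.
rewrite !p1 !p2 // opprD.
(* With only two factors, [r] acting on legs 0 and 1 is [r] itself. *)
have -> : r F = part r o0 o1 F - part r o1 o0 F.
  rewrite -leg_part //; apply: coordP => v; rewrite legE; congr (r _ _).
    apply: coordP => w; congr (F _); apply: power_eq => b; rewrite of_factorsK.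
    by case: b => [[|[|]]] //= p; congr factor; exact: val_inj.
  apply: power_eq => b; rewrite of_factorsK.
  by case: b => [[|[|]]] //= p; congr factor; exact: val_inj.
by rewrite [X in X + _ + _]addrCA subrr addr0 addrA addrK addrC.
Qed.

End Quantization.

Lemma classical_rmatrix_quantization :
  exists g : {linear O 2 -> fps (O 2)}, geometric_quantum_Rmatrix g /\ quantizes g r.
Proof.
exists quantum_fun; split; last first.
  by move=> F; split; [exact: quantum_fun_coef0|exact: quantum_fun_coef1].
split.
- by split; [exact: quantum_fun_morphism|exact: quantum_fun_coef0].
- move=> u.
  have u012 : uniq [:: inord 0; inord 1; inord 2 : 'I_3].
    by rewrite /= !inE -!val_eqE /= !inordK.
  move: (u012); rewrite /= !inE negb_or => /and3P[/andP[n01 n02] n12 _].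
  rewrite !(fps_leg_quantum _ n01) !(fps_leg_quantum _ n02) !(fps_leg_quantum _ n12).
  exact: exchange_YBE u012.
- by move=> u; rewrite !fps_ext_quantum exchange_unitary.
Qed.

End Twist.

Theorem theorem1p1 (R : realType) (n : nat) (X : set 'rV[R[i]]_n)
    (hX : smooth_affine_variety X)
    (r : {linear coord_ring (power X 2) -> coord_ring (power X 2)})
    (hr : geometric_classical_rmatrix r) :
  exists g : {linear coord_ring (power X 2) -> fps (coord_ring (power X 2))},
    geometric_quantum_Rmatrix g /\ quantizes g r.
Proof.
apply: classical_rmatrix_quantization => //.
by apply/pcharf0P => k; exact: Num.Theory.pnatr_eq0.
Qed.
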